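(* Let $n\ge1$ and $p\ge1$ be integers, and suppose that $$f(x)=x\sum_{k=0}^\infty\frac{(a_1)_k\cdots(a_p)_k}{(b_1)_k\cdots(b_p)_k}x^k$$ is an eigenfunction of $U_n$ with eigenvalue $\lambda$. Let $\gamma_a=|\{i\in\{1,\dots,p\}:a_i=1\}|$ and $\gamma_b=|\{i\in\{1,\dots,p\}:b_i=1\}|$. Then $$\lambda=n^{\gamma_b-\gamma_a}.$$
   Context: For $n\ge1$ the operator $U_n$ acts on formal power series with complex coefficients by $U_n\left(\sum_{k\ge0}c_kx^k\right)=\sum_{k\ge0}c_{nk}x^k$; an eigenfunction with eigenvalue $\lambda\in\mathbb{C}$ is a nonzero $f$ with $U_nf=\lambda f$. The ascending factorial is $(c)_k=c(c+1)\cdots(c+k-1)$, $(c)_0=1$. The parameters $a_i,b_i$ are nonzero complex numbers and no $b_i$ is a nonpositive integer. Ratios of consecutive coefficients of a hypergeometric series are required to be given by a rational function of $k$; in particular all coefficients are nonzero, i.e. no $a_i$ is a nonpositive integer. *)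

(* Defs.v *)
From mathcomp Require Import all_boot all_order all_algebra.
From mathcomp Require Import boolp functions reals.
From mathcomp Require Export complex.

Set Implicit Arguments.
Unset Strict Implicit.
Unset Printing Implicit Defensive.

Import GRing.Theory Num.Theory.
Local Open Scope ring_scope.

(* A formal power series \sum_k c_k x^k is its coefficient sequence k |-> c_k;
   sum and scaling are the pointwise ones of mathcomp.classical.functions. *)
Definition fps (C : Type) := nat -> C.

Definition U_op (C : nzRingType) (n : nat) (c : fps C) : fps C :=
  fun k => c (n * k)%N.

Definition eigenfunction (C : nzRingType) (T : fps C -> fps C) (lambda : C)
    (f : fps C) : Prop :=
  f <> (0 : nat -> C) /\ T f = lambda *: (f : nat -> C^o).

Definition mulx (C : nzRingType) (c : fps C) : fps C :=
  fun k => if k is k'.+1 then c k' else 0.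

Definition ascfact (C : nzRingType) (c : C) (k : nat) : C :=
  \prod_(i < k) (c + i%:R).

Definition hypergeom (C : fieldType) (p : nat) (a b : 'I_p -> C) : fps C :=
  fun k => (\prod_(i < p) ascfact (a i) k) / (\prod_(i < p) ascfact (b i) k).

Definition nonpos_integer (C : nzRingType) (z : C) : Prop :=
  exists m : nat, z = - m%:R.

(* Main.v *)
Require Import Defs.
From mathcomp Require Import all_boot all_order all_algebra.
From mathcomp Require Import boolp reals ring.

Set Implicit Arguments.
Unset Strict Implicit.
Unset Printing Implicit Defensive.

Import Order.TTheory GRing.Theory Num.Theory.
Local Open Scope ring_scope.

(** Let d_k be the coefficient of x^k in f, so that d_1 = 1 and
    d_(k+1) / d_k = A(k) / B(k) for k >= 1, where A and B are the monic
    polynomials with roots 1 - a_i and 1 - b_i.  When n = 1 the eigenvalue is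
    visibly 1; let n >= 2.

    Comparing d_(n(k+1)) / d_(nk) with d_(k+1) / d_k turns the eigenfunction
    equation into an identity of polynomials,
      A(x) B(nx) B(nx+1) ... B(nx+n-1) = B(x) A(nx) A(nx+1) ... A(nx+n-1),
    that is, an equality between multisets of roots ([perm_eq_eigen]).

    The multiset equation is solved by counting, for each z, the roots lying in
    z + {0, 1, 2, ...}.  Let S(z) be the number of such roots of A minus that
    of B.  A root x of A produces the roots (x - j) / n, 0 <= j < n, of the
    product of the A(nx + j); by Euclidean division at most one of them lies in
    z + {0, 1, ...}, and one does exactly when x lies in nz + {0, 1, ...}.
    Hence S(z) = S(nz).  If S(z) <> 0 then every z / n^k has S(z / n^k) <> 0,
    so some root of A or B lies above it.  There are finitely many roots, so
    infinitely many of these points, which tend to 0, are congruent modulo the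
    integers, and this forces z = 0 ([chain_trivial]).  So S vanishes outside
    0, and the multiplicity S(z) - S(z + 1) of z as a zero of A / B is S(0) at
    z = 0, - S(0) at z = -1 and 0 elsewhere ([perm_eq_power]): with
    s = - S(0) = gamma_b - gamma_a,
      A(x) / B(x) = ((x + 1) / x)^s.
    The recurrence telescopes to d_k = k^s ([coef_power]), and
    lambda = d_n / d_1 = n^s. *)

Lemma big_iota_ord (C : comNzRingType) (n : nat) (F : nat -> C) :
  \prod_(j <- iota 0 n) F j = \prod_(j < n) F j.
Proof. by rewrite -[in LHS](subn0 n) -/(index_iota 0 n) big_mkord. Qed.

(** * Multisets of roots *)

Section Counting.
Variable C : numFieldType.
Implicit Types (z x : C) (u v w : seq C).

Definition poly_of_roots w : {poly C} := \prod_(x <- w) ('X - x%:P).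

Lemma horner_poly_of_roots w x : (poly_of_roots w).[x] = \prod_(y <- w) (x - y).
Proof.
by rewrite horner_prod; apply: eq_bigr => y _; rewrite hornerXsubC.
Qed.

(** The inverse images of the entries of [w] under the maps x |-> n x + j,
    0 <= j < n, with multiplicity. *)
Definition preimages (n : nat) w : seq C :=
  [seq (x - j%:R) / n%:R | x <- w, j <- iota 0 n].

(** Each factor n x + j - y is n (x - (y - j) / n); the power of n collects the
    leading coefficients. *)
Lemma horner_preimages n w x : (0 < n)%N ->
  (poly_of_roots (preimages n w)).[x] * n%:R ^+ (n * size w) =
    \prod_(j < n) (poly_of_roots w).[n%:R * x + j%:R].
Proof.
move=> n_gt0; have nz : n%:R != 0 :> C by rewrite pnatr_eq0 -lt0n.
under [RHS]eq_bigr do rewrite horner_poly_of_roots.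
rewrite horner_poly_of_roots /preimages big_allpairs_dep exchange_big /=.
elim: w => [|y w IHw].
  by rewrite muln0 expr0 mulr1 exchange_big !big_nil exchange_big big_nil.
under [RHS]eq_bigr do rewrite big_cons.
rewrite exchange_big big_cons exchange_big /= big_split /= -IHw mulnS exprD.
rewrite mulrACA; congr (_ * _).
rewrite big_iota_ord -[X in _ * _ ^+ X]card_ord -prodr_const -big_split /=.
apply: eq_bigr => j _.
by rewrite mulrBl divfK // [x * _]mulrC opprB addrA.
Qed.

Lemma poly_eq_on_nat (p q : {poly C}) :
  (forall k : nat, (0 < k)%N -> p.[k%:R] = q.[k%:R]) -> p = q.
Proof.
move=> pq; apply/eqP; rewrite -subr_eq0; apply: contraT => nz.
pose s : seq C := [seq k%:R | k <- iota 1 (size (p - q))].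
have : (size s < size (p - q)%R)%N.
  apply: max_poly_roots => //.
    apply/allP => x /mapP[k]; rewrite mem_iota => /andP[k_gt0 _] ->.
    by rewrite rootE hornerD hornerN pq // subrr.
  rewrite map_inj_uniq ?iota_uniq // => i j /eqP.
  by rewrite eqr_nat => /eqP.
by rewrite size_map size_iota ltnn.
Qed.

(** * Counting roots in the cones z + {0, 1, 2, ...} *)

Definition nat_above z x : bool := `[< exists m : nat, x = z + m%:R >].

Lemma nat_aboveP z x : reflect (exists m : nat, x = z + m%:R) (nat_above z x).
Proof. exact: asboolP. Qed.

(** Euclidean division: (n z + m - j) / n lies in z + {0, 1, ...} exactly for
    the residue j of m. *)
Lemma nat_above_preimages n z x : (0 < n)%N ->
  count (nat_above z) [seq (x - j%:R) / n%:R | j <- iota 0 n] =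
    nat_above (n%:R * z) x.
Proof.
move=> n_gt0; have nz : n%:R != 0 :> C by rewrite pnatr_eq0 -lt0n.
rewrite count_map; case: nat_aboveP => [[m ->] | none] /=.
  transitivity (count_mem (m %% n)%N (iota 0 n)); last first.
    by rewrite count_uniq_mem ?iota_uniq // mem_iota add0n ltn_pmod.
  apply: eq_in_count => j; rewrite mem_iota add0n /= => j_lt.
  apply/nat_aboveP/eqP => [[q] | ->].
    move/(congr1 (fun t => t * n%:R)); rewrite divfK // mulrDl [z * _]mulrC.
    rewrite -addrA => /addrI /eqP.
    rewrite subr_eq -natrM -natrD eqr_nat => /eqP ->.
    by rewrite modnMDl modn_small.
  exists (m %/ n)%N; rewrite {1}(divn_eq m n) natrD natrM addrA addrK.
  by rewrite mulrDl mulfK // mulrC mulKf.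
apply/eqP; rewrite -leqn0 leqNgt -has_count; apply/hasP => -[j _ /=].
case/nat_aboveP => q /(congr1 (fun t => t * n%:R)); rewrite divfK //.
move/eqP; rewrite subr_eq mulrDl [z * _]mulrC -addrA => /eqP xE.
by apply: none; exists (q * n + j)%N; rewrite natrD natrM.
Qed.

Lemma count_nat_above_preimages n z w : (0 < n)%N ->
  count (nat_above z) (preimages n w) = count (nat_above (n%:R * z)) w.
Proof.
move=> n_gt0; elim: w => [//|x w IHw].
by rewrite /preimages /= count_cat nat_above_preimages // -IHw.
Qed.

Lemma count_nat_aboveS z w :
  count (nat_above z) w = (count_mem z w + count (nat_above (z + 1)) w)%N.
Proof.
rewrite -count_predUI [X in (_ + X)%N](@eq_count _ _ pred0) ?count_pred0 ?addn0.
  apply: eq_count => x /=; apply/nat_aboveP/orP => [[[|m] ->] | [/eqP -> | ]].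
  - by left; rewrite addr0.
  - by right; apply/nat_aboveP; exists m; rewrite -addrA -natr1 [1 + _]addrC.
  - by exists 0%N; rewrite addr0.
  - by case/nat_aboveP=> m ->; exists m.+1; rewrite -addrA -natr1 [1 + _]addrC.
move=> x /=; apply/negP => /andP[/eqP -> /nat_aboveP[m /eqP]].
rewrite -subr_eq0 -addrA opprD addrA subrr add0r oppr_eq0 -[1 + _]addrC natr1.
by rewrite pnatr_eq0.
Qed.

(** Pigeonhole on the points z / n^k with k >= K: two of them lie below the same
    entry of [w], so their difference z / n^k - z / n^(k + d) is an integer of
    absolute value m.  The conclusion is this equation cleared of denominators. *)
Lemma chain_collision n z w K : (0 < n)%N ->
    (forall k, has (nat_above (z / n%:R ^+ k)) w) ->
  exists k d m : nat, [/\ (K <= k)%N, (0 < d)%N &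
    `|z| * (n%:R ^+ d - 1) = m%:R * n%:R ^+ (k + d)].
Proof.
move=> n_gt0 all_has; have nz : n%:R != 0 :> C by rewrite pnatr_eq0 -lt0n.
pose f (k : 'I_(size w).+1) := find (nat_above (z / n%:R ^+ (K + k))) w.
have f_lt k : (f k < size w)%N by rewrite -has_find.
pose g k := Ordinal (f_lt k).
have /injectivePn[k1 [k2 ne12 eqg]] : ~~ injectiveb g.
  apply/injectiveP => /leq_card; by rewrite !card_ord ltnn.
have {eqg} eqf : f k1 = f k2 by move/(congr1 val): eqg.
wlog lt12 : k1 k2 ne12 eqf / (k1 < k2)%N.
  move=> W; case: (ltngtP k1 k2) => [lt|lt|/val_inj eq].
  - exact: W lt.
  - by apply: (W k2 k1) => //; rewrite eq_sym.
  - by rewrite eq eqxx in ne12.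
have /nat_aboveP[m1 e1] := nth_find 0 (all_has (K + k1)%N).
have /nat_aboveP[m2] := nth_find 0 (all_has (K + k2)%N).
(* Both k1 and k2 point to the same entry of w, so the two decompositions
   of that entry can be compared. *)
rewrite -[find _ _]/(f k2) -eqf e1 => {}e1.
pose d := (k2 - k1)%N.
have d_gt0 : (0 < d)%N by rewrite subn_gt0.
have K2 : (K + k2 = K + k1 + d)%N by rewrite -addnA subnKC // ltnW.
exists (K + k1)%N, d, `|(m2%:Z - m1%:Z)%R|%N; split; rewrite ?leq_addr //.
have npow : 1 <= n%:R ^+ d :> C by rewrite exprn_ege1 // ler1n.
have -> : `|(m2%:Z - m1%:Z)|%N%:R = `|m2%:R - m1%:R| :> C.
  by rewrite -[LHS]pmulrn natr_absz intr_norm intrB.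
rewrite -[X in _ * X]ger0_norm ?subr_ge0 // -normrM.
rewrite -[X in _ = _ * X]ger0_norm ?exprn_ge0 ?ler0n // -normrM.
congr `|_|.
have e : m2%:R - m1%:R = z / n%:R ^+ (K + k1) - z / n%:R ^+ (K + k2).
  by apply/eqP; rewrite subr_eq addrAC e1 addrAC subrr add0r.
rewrite e K2 mulrBl mulrBr mulr1 divfK ?expf_neq0 //.
by rewrite (exprD _ (K + k1)) mulrA divfK ?expf_neq0.
Qed.

(** A first collision bounds |z| by a natural number N, which replaces an
    appeal to the Archimedean property; a second one, among the points
    z / n^k with k >= N, then makes an integer difference smaller than 1. *)
Lemma chain_trivial n z w : (1 < n)%N ->
  (forall k, has (nat_above (z / n%:R ^+ k)) w) -> z = 0.
Proof.
move=> n_gt1 all_has; have n_gt0 := ltnW n_gt1.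
have pow_ge d : (0 < d)%N -> 1 <= n%:R ^+ d - 1 :> C.
  move=> d_gt0; rewrite lerBrDr -natrX -(natrD _ 1 1) ler_nat addn1.
  by rewrite -{1}(exp1n d) ltn_exp2r.
have [k0 [d0 [m0 [_ d0_gt0 e0]]]] := chain_collision 0 n_gt0 all_has.
pose N := (m0 * n ^ (k0 + d0))%N.
have z_le : `|z| <= N%:R.
  rewrite natrM natrX -e0 ler_peMr //; exact: pow_ge.
have [k [d [m [k_ge d_gt0 e]]]] := chain_collision N n_gt0 all_has.
(* Now the difference z / n ^ k - z / n ^ (k + d) has absolute value m; m = 0
   gives z = 0, and m > 0 contradicts k < n ^ k. *)
have [m0E | m_gt0] := posnP m.
  move/eqP: e; rewrite m0E mul0r mulf_eq0 normr_eq0 => /orP[/eqP // | ].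
  by move/eqP=> h; have := pow_ge d d_gt0; rewrite h ler10.
have : (n ^ (k + d) <= N * n ^ d)%N.
  rewrite -(ler_nat C) natrX (natrM _ N) natrX.
  apply: (le_trans (y := m%:R * n%:R ^+ (k + d))).
    by rewrite ler_peMl ?exprn_ge0 ?ler0n // ler1n.
  rewrite -e; apply: ler_pM => //; last by rewrite lerBlDr lerDl ler01.
  exact: le_trans (ler01) (pow_ge _ d_gt0).
rewrite expnD leq_pmul2r ?expn_gt0 ?n_gt0 // leqNgt.
by rewrite (leq_ltn_trans k_ge) // ltn_expl.
Qed.

(** The multiset equation says that the difference of the two counts takes the
    same value at z and at n z, so a nonzero difference at z propagates to every
    z / n^k. *)
Lemma count_nat_above_eq n u v z : (1 < n)%N -> z != 0 ->
    perm_eq (u ++ preimages n v) (v ++ preimages n u) ->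
  count (nat_above z) u = count (nat_above z) v.
Proof.
move=> n_gt1 nz_z uv; have n_gt0 := ltnW n_gt1.
have nz : n%:R != 0 :> C by rewrite pnatr_eq0 -lt0n.
apply/eqP; apply: contraT => ne.
suff /(chain_trivial n_gt1) z0 :
    forall k, has (nat_above (z / n%:R ^+ k)) (u ++ v).
  by rewrite z0 eqxx in nz_z.
have chain k :
    count (nat_above (z / n%:R ^+ k)) u != count (nat_above (z / n%:R ^+ k)) v.
  elim: k => [|k]; first by rewrite expr0 divr1.
  apply: contra => /eqP eqk.
  have /permP/(_ (nat_above (z / n%:R ^+ k.+1))) := uv.
  rewrite !count_cat !count_nat_above_preimages // eqk.
  rewrite (_ : n%:R * (z / _) = z / n%:R ^+ k); last first.
    by rewrite exprS invfM mulrCA mulVKf.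
  by move/addnI ->.
move=> k; rewrite has_count count_cat lt0n.
by apply: contra (chain k); rewrite addn_eq0 => /andP[/eqP -> /eqP ->].
Qed.

(** The multiplicity of z is the count above z minus the count above z + 1.  The
    counts for [u] and [v] differ at most above 0, so the multiplicities differ
    at most at 0 and -1, in opposite ways.  On the rational function with zeros
    [u] and poles [v] this says that it is a power of (x + 1) / x, both
    sides being padded so as to compare multisets without subtraction. *)
Lemma perm_eq_power n u v : (1 < n)%N ->
    perm_eq (u ++ preimages n v) (v ++ preimages n u) ->
  perm_eq (u ++ nseq (count_mem 0 v) 0 ++ nseq (count_mem 0 u) (-1))
          (v ++ nseq (count_mem 0 u) 0 ++ nseq (count_mem 0 v) (-1)).
Proof.
move=> n_gt1 uv; apply/allP => z _; apply/eqP => /=.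
have above y (ny : y != 0) := count_nat_above_eq n_gt1 ny uv.
have above1 : count (nat_above 1) u = count (nat_above 1) v.
  exact/above/oner_neq0.
have u0 := count_nat_aboveS 0 u; have v0 := count_nat_aboveS 0 v.
rewrite add0r in u0 v0.
have uz := count_nat_aboveS z u; have vz := count_nat_aboveS z v.
rewrite !count_cat !count_nseq /=.
have [z0 | nz] := eqVneq z 0.
  rewrite z0 oppr_eq0 oner_eq0 !mul1n !mul0n !addn0; exact: addnC.
rewrite !mul0n !add0n.
have [z1 | nz1] := eqVneq z (-1).
  rewrite !mul1n.
  have zz : z + 1 = 0 by rewrite z1 addNr.
  by have := above z nz; rewrite uz vz zz u0 v0 above1 !addnA => /addIn.
rewrite !mul0n !addn0.
have := above z nz; rewrite uz vz (above (z + 1)); first exact: addIn.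
by rewrite addr_eq0.
Qed.

(** * Eigenfunctions whose coefficient ratio is a rational function *)

Section Recurrence.
Variables (n : nat) (lambda : C) (u v : seq C) (d : nat -> C).
Hypothesis n_gt1 : (1 < n)%N.
Hypothesis size_uv : size u = size v.
Hypothesis u_neq0 : forall k, (0 < k)%N -> (poly_of_roots u).[k%:R] != 0.
Hypothesis v_neq0 : forall k, (0 < k)%N -> (poly_of_roots v).[k%:R] != 0.
Hypothesis d1 : d 1 = 1.
Hypothesis dS : forall k, (0 < k)%N ->
  d k.+1 * (poly_of_roots v).[k%:R] = d k * (poly_of_roots u).[k%:R].
Hypothesis d_eigen : forall k, d (n * k)%N = lambda * d k.

Lemma coef_neq0 k : (0 < k)%N -> d k != 0.
Proof.
elim: k => [//|[_ _|k IHk _]]; first by rewrite d1 oner_neq0.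
have : d k.+2 * (poly_of_roots v).[k.+1%:R] != 0.
  by rewrite dS // mulf_neq0 ?IHk ?u_neq0.
by rewrite mulf_eq0 negb_or => /andP[].
Qed.

Lemma coef_iter k m : (0 < k)%N ->
  d (k + m)%N * \prod_(j < m) (poly_of_roots v).[(k + j)%:R] =
    d k * \prod_(j < m) (poly_of_roots u).[(k + j)%:R].
Proof.
move=> k_gt0; elim: m => [|m IHm]; first by rewrite addn0 !big_ord0.
rewrite !big_ord_recr /= addnS [in LHS]mulrCA dS ?addn_gt0 ?k_gt0 //.
by rewrite mulrCA [in RHS]mulrA -IHm; ring.
Qed.

(** The ratio of d (n (k + 1)) to d (n k) is both the product of n consecutive
    ratios and, after cancelling lambda, the single ratio of d (k + 1) to d k.
    As [u] and [v] have the same size, the leading coefficients n^(n size) on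
    the two sides cancel. *)
Lemma perm_eq_eigen : perm_eq (u ++ preimages n v) (v ++ preimages n u).
Proof.
have n_gt0 := ltnW n_gt1.
have nz : n%:R != 0 :> C by rewrite pnatr_eq0 -lt0n.
have lambda_neq0 : lambda != 0.
  by rewrite -[lambda]mulr1 -d1 -d_eigen muln1 coef_neq0.
apply: prod_XsubC_eq; rewrite !big_cat /= -!/(poly_of_roots _).
apply: poly_eq_on_nat => k k_gt0; rewrite !hornerM.
apply: (@mulIf _ (n%:R ^+ (n * size u))); first by rewrite expf_neq0.
rewrite -!mulrA {1}size_uv !horner_preimages //.
have nk_gt0 : (0 < n * k)%N by rewrite muln_gt0 n_gt0.
have := coef_iter n nk_gt0; rewrite -mulnSr !d_eigen.
under eq_bigr do rewrite natrD natrM.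
under [in X in _ = X -> _]eq_bigr do rewrite natrD natrM.
set pv := \prod_(j < n) _; set pu := \prod_(j < n) _.
rewrite -!mulrA => /(mulfI lambda_neq0) step.
apply: (mulfI (coef_neq0 k_gt0)); rewrite !mulrA -dS // mulrAC step.
by ring.
Qed.

(** The telescoping of the ratios ((k + 1) / k)^s, with the negative part of the
    exponent moved to the left. *)
Lemma coef_power k : (0 < k)%N ->
  d k * k%:R ^+ count_mem 0 u = k%:R ^+ count_mem 0 v.
Proof.
have uvE : poly_of_roots _ = poly_of_roots _ :=
  perm_big _ (perm_eq_power n_gt1 perm_eq_eigen).
elim: k => [//|[_ _|k IHk _]]; first by rewrite d1 !expr1n mulr1.
have /(congr1 (fun q : {poly C} => q.[k.+1%:R])) := uvE.
rewrite /poly_of_roots !big_cat /= !big_nseq !iter_mulr_1 -!/(poly_of_roots _).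
rewrite !(hornerM, horner_exp, hornerXsubC) subr0 opprK natr1 => {}uvE.
have k1nz : k.+1%:R != 0 :> C by rewrite pnatr_eq0.
apply: (mulIf (v_neq0 (ltn0Sn k))).
apply: (mulIf (expf_neq0 (count_mem 0 u) k1nz)).
rewrite [_ * _ * (poly_of_roots v).[_]]mulrAC dS //.
transitivity ((poly_of_roots v).[k.+1%:R] *
    (k.+1%:R ^+ count_mem 0 u * k.+2%:R ^+ count_mem 0 v)); last by ring.
by rewrite -uvE -IHk //; ring.
Qed.

Lemma eigenvalue_power :
  lambda = n%:R ^ ((count_mem 0 v)%:Z - (count_mem 0 u)%:Z).
Proof.
have n_gt0 := ltnW n_gt1.
have nz : n%:R != 0 :> C by rewrite pnatr_eq0 -lt0n.
rewrite expfzDr // -exprnN -exprnP -(coef_power n_gt0) mulfK ?expf_neq0 //.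
by rewrite -{1}[n]muln1 d_eigen d1 mulr1.
Qed.
End Recurrence.
End Counting.

(** * The hypergeometric series *)

Lemma ascfactS (C : nzRingType) (c : C) k :
  ascfact c k.+1 = ascfact c k * (c + k%:R).
Proof. by rewrite /ascfact big_ord_recr. Qed.

Section Hypergeometric.
Variables (C : numFieldType) (p : nat).
Implicit Types a b : 'I_p -> C.

(** The shift by 1 accounts for the factor x in f: the coefficient of x^(k+1)
    is the k-th hypergeometric coefficient, with ratio factors a_i + k. *)
Definition ratio_roots a : seq C := [seq 1 - a i | i <- enum 'I_p].

Lemma horner_ratio_roots a k :
  (poly_of_roots (ratio_roots a)).[k.+1%:R] = \prod_(i < p) (a i + k%:R).
Proof.
rewrite horner_poly_of_roots big_map big_enum; apply: eq_bigr => i _.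
by rewrite opprB addrA addrAC -natr1 addrK addrC.
Qed.

Lemma ratio_roots_neq0 a k : (forall i, ~ nonpos_integer (a i)) ->
  (0 < k)%N -> (poly_of_roots (ratio_roots a)).[k%:R] != 0.
Proof.
case: k => // k ha _; rewrite horner_ratio_roots.
apply/prodf_neq0 => i _; apply/eqP => /eqP; rewrite addr_eq0 => /eqP ai.
by apply: (ha i); exists k.
Qed.

Lemma count_ratio_roots a : count_mem 0 (ratio_roots a) = #|[set i | a i == 1]|.
Proof.
rewrite count_map -size_filter cardsE cardE; congr size.
rewrite enumT /enum_mem; apply: eq_filter => i /=.
by rewrite subr_eq0 eq_sym.
Qed.

Lemma hypergeomS a b k : (forall i, ~ nonpos_integer (b i)) ->
  hypergeom a b k.+1 * (poly_of_roots (ratio_roots b)).[k.+1%:R] =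
    hypergeom a b k * (poly_of_roots (ratio_roots a)).[k.+1%:R].
Proof.
move=> hb; have := ratio_roots_neq0 hb (ltn0Sn k).
rewrite !horner_ratio_roots /hypergeom => nz.
under eq_bigr do rewrite ascfactS.
under [X in _ / X * _]eq_bigr do rewrite ascfactS.
by rewrite !big_split /= invfM mulrA -mulrA mulVf // mulr1 mulrAC.
Qed.
End Hypergeometric.

Theorem theorem6p13 (R : realType) (n p : nat) (a b : 'I_p -> R[i])
    (lambda : R[i])
    (hn : (1 <= n)%N) (hp : (1 <= p)%N)
    (ha0 : forall i, a i != 0) (hb0 : forall i, b i != 0)
    (ha : forall i, ~ nonpos_integer (a i))
    (hb : forall i, ~ nonpos_integer (b i))
    (hf : eigenfunction (U_op n) lambda (mulx (hypergeom a b))) :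
  let gamma_a : nat := #|[set i | a i == 1]| in
  let gamma_b : nat := #|[set i | b i == 1]| in
  lambda = (n%:R : R[i]) ^ (gamma_b%:Z - gamma_a%:Z).
Proof.
move=> gamma_a gamma_b; case: hf => _ /funeqP Uf.
have d1 : mulx (hypergeom a b) 1 = 1.
  rewrite /= /hypergeom; under eq_bigr do rewrite /ascfact big_ord0.
  under [X in _ / X]eq_bigr do rewrite /ascfact big_ord0.
  by rewrite !big1 // divr1.
have d_eigen k : mulx (hypergeom a b) (n * k) = lambda * mulx (hypergeom a b) k.
  exact: Uf k.
have [n_gt1 | n_le1] := ltnP 1 n; last first.
  have n1 : n = 1%N by apply/eqP; rewrite eqn_leq n_le1.
  by have := d_eigen 1%N; rewrite n1 d1 exp1rz mulr1.
rewrite /gamma_a /gamma_b -!count_ratio_roots.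
apply: (eigenvalue_power n_gt1 _ _ _ d1 _ d_eigen).
- by rewrite !size_map.
- by move=> k; apply: ratio_roots_neq0.
- by move=> k; apply: ratio_roots_neq0.
- by case=> // k _; apply: hypergeomS.
Qed.
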